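(* For any $(x,y)\in P\cap\mathbb{R}^{m+s}_{++}$, $$G(x,y)=\frac{1}{m+s}\times\max\Big\{m+s-D^-(x,y),\ m+s-\frac{D^+(x,y)}{1+D^+(x,y)}\Big\}.$$
   Context: Notation: vector inequalities are componentwise ($a\le b$ means $a_i\le b_i$ for all $i$; $a<b$ means $a_i<b_i$ for all $i$). $\mathbb{R}_+$ denotes the nonnegative reals and $\mathbb{R}_{++}$ the positive reals. $e_l$ is the $l$-th unit vector and $e$ the all-ones vector of the space of appropriate dimension. Let $m,s,n\ge 1$ be integers. Data: observed input-output vectors $(x_j,y_j)\in\mathbb{R}^{m+s}_{++}$, $j=1,\dots,n$ (with $x_j\in\mathbb{R}^m$, $y_j\in\mathbb{R}^s$). The production possibility set (variable returns to scale) is $$P=\Big\{(x,y)\in\mathbb{R}^{m+s}_+ : \exists \lambda\ge 0,\ \sum_{j=1}^n\lambda_jx_j\le x,\ \sum_{j=1}^n\lambda_jy_j\ge y,\ \sum_{j=1}^n\lambda_j=1\Big\}.$$ For a set $\mathcal{P}\subseteq\mathbb{R}^{m+s}_+$, the weakly efficient frontier $\partial^w(\mathcal{P})$ is the set of $(x,y)\in\mathcal{P}$ such that $(x',-y')<(x,-y)$ implies $(x',y')\notin\mathcal{P}$; the strongly efficient frontier $\partial^s(\mathcal{P})$ is the set of $(x,y)\in\mathcal{P}$ such that $(x',y')\ne(x,y)$ and $(x',-y')\le(x,-y)$ imply $(x',y')\notin\mathcal{P}$. A face of $P$ is a set $\mathcal{F}=P\cap\{(x,y): -v^\top x+u^\top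 y-\psi=0\}$ with $(v,u,\psi)\in\mathbb{R}^{m+s}_+\times\mathbb{R}$ such that $-v^\top x+u^\top y-\psi\le 0$ for all $(x,y)\in P$. A full-dimensional efficient facet (FDEF) of $P$ is a face $\mathcal{F}\subseteq\partial^s(P)$ with $\dim\mathcal{F}=m+s-1$. Assume $P$ has at least one FDEF, and let $\mathcal{F}_1,\dots,\mathcal{F}_K$ be all the FDEFs of $P$. For each $k$ there are $(v^k,u^k)\in\mathbb{R}^{m+s}_{++}$ and $\psi^k\in\mathbb{R}$ with $\mathcal{F}_k=P\cap\{(x,y): -v^{k\top}x+u^{k\top}y-\psi^k=0\}$ and $-v^{k\top}x+u^{k\top}y-\psi^k\le0$ on $P$. The extended facet production possibility set is $$P_{EXFA}=\Big\{(x,y)\in\mathbb{R}^{m+s}_+ : -\sum_{i=1}^m v^k_ix_i+\sum_{r=1}^s u^k_ry_r\le\psi^k,\ k=1,\dots,K\Big\}.$$ For $(x,y)\in P\cap\mathbb{R}^{m+s}_{++}$, the maximum Russell graph measure $G(x,y)$ is the maximum of $\frac{1}{m+s}\big(\sum_{i=1}^m\theta_i+\sum_{r=1}^s\frac{1}{\phi_r}\big)$ over all $(\theta,\phi)$ with $0\le\theta_i\le1$ ($i=1,\dots,m$), $1\le\phi_r$ ($r=1,\dots,s$) and $\big(\sum_{i=1}^m\theta_ix_ie_i,\sum_{r=1}^s\phi_ry_re_r\big)\in\partial^s(P_{EXFA})$. The commensurable Hölder input and output distance functions are $$D^-(x,y)=\min\Big\{\sum_{i=1}^m(1-\theta_i)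 : \Big(\sum_{i=1}^m\theta_ix_ie_i,\,y\Big)\in\partial^w(P_{EXFA}),\ 0\le\theta\le e\Big\},$$ $$D^+(x,y)=\min\Big\{\sum_{r=1}^s(\phi_r-1) : \Big(x,\,\sum_{r=1}^s\phi_ry_re_r\Big)\in\partial^w(P_{EXFA}),\ e\le\phi\Big\}.$$ *)

(* Defs.v *)
From mathcomp Require Import all_boot all_order all_algebra.
From mathcomp Require Import boolp classical_sets functions reals.

Set Implicit Arguments.
Unset Strict Implicit.
Unset Printing Implicit Defensive.

Import Order.TTheory GRing.Theory Num.Theory.
Local Open Scope classical_set_scope.
Local Open Scope ring_scope.

Definition vle (R : realType) (n : nat) (a b : 'rV[R]_n) : Prop :=
  forall i, a 0 i <= b 0 i.

Definition vlt (R : realType) (n : nat) (a b : 'rV[R]_n) : Prop :=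
  forall i, a 0 i < b 0 i.

Definition dot (R : realType) (n : nat) (a b : 'rV[R]_n) : R :=
  \sum_i a 0 i * b 0 i.

(* The vector whose i-th coordinate is [t_i * a_i], i.e. [\sum_i t_i a_i e_i]. *)
Definition vscale (R : realType) (n : nat) (t a : 'rV[R]_n) : 'rV[R]_n :=
  \row_i (t 0 i * a 0 i).

Definition is_max (R : realType) (A : set R) (a : R) : Prop :=
  A a /\ ubound A a.

Definition is_min (R : realType) (A : set R) (a : R) : Prop :=
  A a /\ lbound A a.

(* An input-output vector (x, y) of R^(m+s) is a pair. *)
Definition io (R : realType) (m s : nat) : Type := ('rV[R]_m * 'rV[R]_s)%type.

Section Affine_dimension.
Context (R : realType) (m s : nat).
Implicit Types (S : set ('rV[R]_m * 'rV[R]_s)%type) (d : nat).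

Definition contains_differences S
    (W : {vspace ('rV[R]_m * 'rV[R]_s)%type}) : Prop :=
  forall p q, S p -> S q -> p - q \in W.

(* The nonempty set S has an affine hull of dimension d: the direction of the
   affine hull is the least linear subspace containing all differences of
   points of S. *)
Definition has_dim S d : Prop :=
  S !=set0 /\
  exists W : {vspace ('rV[R]_m * 'rV[R]_s)%type},
    [/\ contains_differences S W,
        (forall W' : {vspace ('rV[R]_m * 'rV[R]_s)%type},
           contains_differences S W' -> (W <= W')%VS) &
        \dim W = d].

End Affine_dimension.

Section Technology.
Context (R : realType) (m s : nat).
Implicit Types (S F : set (io R m s)).

Definition pps (n : nat) (X : 'I_n -> 'rV[R]_m) (Y : 'I_n -> 'rV[R]_s) :
    set (io R m s) :=
  [set p | [/\ vle 0 p.1, vle 0 p.2 &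
     exists l : 'rV[R]_n,
       [/\ vle 0 l,
           vle (\sum_j l 0 j *: X j) p.1,
           vle p.2 (\sum_j l 0 j *: Y j) &
           \sum_j l 0 j = 1]]].

Definition weak_frontier S : set (io R m s) :=
  [set p | S p /\
     forall q : io R m s, vlt q.1 p.1 -> vlt (- q.2) (- p.2) -> ~ S q].

Definition strong_frontier S : set (io R m s) :=
  [set p | S p /\
     forall q : io R m s,
       q <> p -> vle q.1 p.1 -> vle (- q.2) (- p.2) -> ~ S q].

Definition hyperplane_fun (v : 'rV[R]_m) (u : 'rV[R]_s) (psi : R)
    (p : io R m s) : R :=
  - dot v p.1 + dot u p.2 - psi.

Definition face_by S (v : 'rV[R]_m) (u : 'rV[R]_s) (psi : R) F : Prop :=
  (forall p, S p -> hyperplane_fun v u psi p <= 0) /\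
  F = S `&` [set p | hyperplane_fun v u psi p = 0].

Definition is_face S F : Prop :=
  exists v u psi, [/\ vle 0 v, vle 0 u & face_by S v u psi F].

Definition is_fdef S F : Prop :=
  [/\ is_face S F, F `<=` strong_frontier S & has_dim F (m + s - 1)].

Definition pps_exfa (K : nat) (v : 'I_K -> 'rV[R]_m) (u : 'I_K -> 'rV[R]_s)
    (psi : 'I_K -> R) : set (io R m s) :=
  [set p | [/\ vle 0 p.1, vle 0 p.2 &
     forall k, - dot (v k) p.1 + dot (u k) p.2 <= psi k]].

(* In the following, S stands for the extended facet technology. *)

Definition russell_values S (x : 'rV[R]_m) (y : 'rV[R]_s) : set R :=
  [set g | exists (theta : 'rV[R]_m) (phi : 'rV[R]_s),
     [/\ vle 0 theta, vle theta (const_mx 1), vle (const_mx 1) phi,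
         strong_frontier S (vscale theta x, vscale phi y) &
         g = (m + s)%:R^-1 *
             (\sum_i theta 0 i + \sum_r (phi 0 r)^-1)]].

Definition input_distance_values S (x : 'rV[R]_m) (y : 'rV[R]_s) : set R :=
  [set d | exists theta : 'rV[R]_m,
     [/\ weak_frontier S (vscale theta x, y),
         vle 0 theta, vle theta (const_mx 1) &
         d = \sum_i (1 - theta 0 i)]].

Definition output_distance_values S (x : 'rV[R]_m) (y : 'rV[R]_s) : set R :=
  [set d | exists phi : 'rV[R]_s,
     [/\ weak_frontier S (x, vscale phi y),
         vle (const_mx 1) phi &
         d = \sum_r (phi 0 r - 1)]].

(* [sup] and [inf] have junk values on empty or unbounded sets: a statement
   about the optima below must also assert that they are attained. *)

Definition russell_measure S x y : R := sup (russell_values S x y).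

Definition input_distance S x y : R := inf (input_distance_values S x y).

Definition output_distance S x y : R := inf (output_distance_values S x y).

End Technology.

(* Main.v *)
Require Import Defs.
From mathcomp Require Import all_boot all_order all_algebra.
From mathcomp Require Import boolp classical_sets functions reals.
From mathcomp Require Import ring lra.

(** The extended facet technology is cut out of the nonnegative orthant by
finitely many half-spaces with strictly positive normals [v k], [u k], so
everything is governed by the slacks
[c k = psi k + dot (v k) x - dot (u k) y >= 0] of the evaluated point.

A point with some zero slack is strongly efficient, because a dominating point
would violate that constraint ([tight_strong_frontier]).  Conversely a weakly
efficient point has a zero slack or a zero input ([weak_frontier_tight]).
Rescaling [(x, y)] by [(theta, phi)] lowers the [k]-th slack by
[\sum_i v_i x_i (1 - theta_i) + \sum_r u_r y_r (phi_r - 1)].  Exhausting a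
linear budget at the least total effort is done along one coordinate, so the
minima defining the two distances are attained by single-coordinate moves:
[D+] is the least ratio [c k / (u_r y_r)], and [D-] is the least ratio
[c k / (v_i x_i)] capped at 1, since by then an input has been driven to 0.

The Russell measure is 1 minus [1 / (m + s)] times the least loss
[\sum_i (1 - theta_i) + \sum_r (1 - 1 / phi_r)].  With
[p = \sum_i (1 - theta_i)] and [q = \sum_r (phi_r - 1)] this loss is at least
[p + q / (1 + q)], which is concave in [(p, q)]; on the budget it is therefore
least at an endpoint, where the whole effort is spent on inputs (loss [D-]) or
on outputs (loss [D+ / (1 + D+)]); this is [mixed_loss_ge].  The inequality
survives the cap on [D-] and the points with a zero input because such points
lose at least 1, whereas [D+ / (1 + D+) < 1].  For the same reason, whenever
[D-] is the smaller loss it is below 1, hence reached at a point with a zero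
slack, which is strongly efficient.  The facets enter through the half-spaces
they define; the existence of one facet ensures that these ratios range over a
nonempty family. *)

Set Implicit Arguments.
Unset Strict Implicit.
Unset Printing Implicit Defensive.

Import Order.TTheory GRing.Theory Num.Theory.
Local Open Scope classical_set_scope.
Local Open Scope ring_scope.

(** * Optima, budgets and losses over the reals *)

Lemma is_max_sup (R : realType) (A : set R) (a : R) : is_max A a -> sup A = a.
Proof.
move=> [Aa ubA]; apply/le_anti/andP; split.
- by apply: ge_sup => //; exists a.
- by apply: ub_le_sup => //; exists a.
Qed.

Lemma is_min_inf (R : realType) (A : set R) (a : R) : is_min A a -> inf A = a.
Proof.
move=> [Aa lbA]; apply/le_anti/andP; split.
- by apply: ge_inf => //; exists a.
- by apply: lb_le_inf => //; exists a.
Qed.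

Lemma weighted_sum_le (R : realType) (J : finType) (a w : J -> R) (c d : R) :
  (forall j, 0 <= w j) -> (forall j, a j * d <= c) ->
  (\sum_j a j * w j) * d <= c * \sum_j w j.
Proof.
move=> w0 ad; rewrite mulr_suml mulr_sumr; apply: ler_sum => j _.
by rewrite mulrAC ler_wpM2r.
Qed.

(** Covering a cost [c] at unit prices [a j] takes a total effort of at least
[d] as soon as no single coordinate moved by [d] overshoots [c]. *)
Lemma budget_le (R : realType) (J : finType) (j0 : J) (a w : J -> R) (c d : R) :
  (forall j, 0 < a j) -> (forall j, 0 <= w j) -> 0 <= d ->
  (forall j, a j * d <= c) -> \sum_j a j * w j = c ->
  d <= \sum_j w j.
Proof.
move=> a0 w0 d0 ad E; have := weighted_sum_le w0 ad; rewrite E.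
have w0' : 0 <= \sum_j w j by apply: sumr_ge0.
have [c0|c0] := ltP 0 c; first by rewrite ler_pM2l.
(* A zero cost forces [d = 0], as seen on the coordinate [j0]. *)
have : a j0 * d <= 0 by apply: le_trans c0.
by rewrite pmulr_rle0 // => d0' _; apply: le_trans w0'.
Qed.

(** The ratio test: [t] is the length of the longest single-coordinate move
that no constraint forbids whatever the coordinate, and it makes some
constraint tight along some coordinate. *)
Lemma first_hit (R : realType) (I J : finType) (i0 : I) (j0 : J)
    (a : I -> J -> R) (c : I -> R) :
  (forall i j, 0 < a i j) -> (forall i, 0 <= c i) ->
  exists (t : R) i j, [/\ 0 <= t, a i j * t = c i &
                    forall i' j', a i' j' * t <= c i'].
Proof.
move=> a0 c0; pose ratio (p : I * J) := c p.1 / a p.1 p.2.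
have [[i j] _ minp] := arg_minP (P := xpredT) (i0 := (i0, j0)) ratio isT.
exists (ratio (i, j)), i, j; split.
- by rewrite divr_ge0 // ltW.
- by rewrite mulrC divfK // gt_eqF.
- by move=> i' j'; rewrite mulrC -ler_pdivlMr //; exact: (minp (i', j')).
Qed.

(** With [w = phi - 1], each term [1 - 1 / phi j] is [w j / (1 + w j)], and
enlarging the denominator to the common [1 + \sum_j w j] only decreases it:
at a given total, spreading an output expansion over several coordinates never
lowers the loss. *)
Lemma ratio_sum_le (R : realType) (J : finType) (phi : J -> R) :
  (forall j, 1 <= phi j) ->
  (\sum_j (phi j - 1)) / (1 + \sum_j (phi j - 1)) <= \sum_j (1 - (phi j)^-1).
Proof.
move=> phi1; set q := \sum_j _.
have w0 j : 0 <= phi j - 1 by rewrite subr_ge0.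
rewrite {1}/q mulr_suml; apply: ler_sum => j _.
have p0 : 0 < phi j by apply: lt_le_trans (phi1 j).
have -> : 1 - (phi j)^-1 = (phi j - 1) / phi j.
  by rewrite mulrBl divff ?gt_eqF // mul1r.
rewrite ler_wpM2l // lef_pV2 ?posrE //.
  by rewrite -lerBlDl /q (bigD1 j) //= lerDl sumr_ge0.
by rewrite ltr_wpDr // sumr_ge0.
Qed.

(** For positive [S], [D] the constraint reads [1 <= p / S + q / D].  The
function [p + q / (1 + q)] is concave and increasing, so on this region it is
least at one of the vertices [(S, 0)] and [(0, D)]; the denominators are
cleared so that the degenerate cases are covered. *)
Lemma mixed_loss_ge (R : realType) (S D p q : R) :
  0 <= S -> 0 <= D -> 0 <= p -> 0 <= q -> S * D <= p * D + q * S ->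
  Num.min S (D / (1 + D)) <= p + q / (1 + q).
Proof.
move=> S0 D0 p0 q0 E.
have D1 : 0 < 1 + D by lra.
have q1 : 0 < 1 + q by lra.
have h0 : 0 <= q / (1 + q) by rewrite divr_ge0 // ltW.
have [Dq|qD] := leP D q.
  rewrite ge_min; apply/orP; right.
  rewrite -[leLHS]add0r lerD // ler_pdivrMr // mulrAC ler_pdivlMr //; lra.
have Dpos : 0 < D by apply: le_lt_trans qD.
rewrite -(ler_pM2r Dpos).
set M := Num.min _ _.
have MS : M <= S by rewrite ge_min lexx.
have MD : M <= D / (1 + D) by rewrite ge_min lexx orbT.
(* [(p, q)] lies above the chord joining the vertices, at weight [q / D];
   the next facts are the chord estimate multiplied by [D]. *)
have h : q * (D / (1 + D)) <= q / (1 + q) * D.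
  rewrite mulrA mulrAC ler_wpM2r // ler_wpM2l // lef_pV2 ?posrE //; lra.
have h1 : (D - q) * M <= (D - q) * S by rewrite ler_wpM2l // subr_ge0 ltW.
have h2 : q * M <= q * (D / (1 + D)) by rewrite ler_wpM2l.
rewrite mulrDl; lra.
Qed.

(** * Vector inequalities and single-coordinate rescalings *)

Section Row_vectors.
Context (R : realType).

Lemma dot_le (n : nat) (w a b : 'rV[R]_n) : vle 0 w -> vle a b ->
  dot w a <= dot w b.
Proof.
move=> w0 ab; apply: ler_sum => i _; apply: ler_wpM2l => //.
by have := w0 i; rewrite mxE.
Qed.

(** Each term of [\sum_j w_j (b_j - a_j) <= 0] is nonnegative, hence zero; the
strict positivity of the weights is what excludes slack in a coordinate. *)
Lemma dot_le_eq (n : nat) (w a b : 'rV[R]_n) : vlt 0 w -> vle a b ->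
  dot w b <= dot w a -> a = b.
Proof.
move=> w0 ab ba; apply/rowP => i.
have w0i j : 0 < w 0 j by have := w0 j; rewrite mxE.
have : \sum_j w 0 j * (b 0 j - a 0 j) == 0.
  rewrite eq_le sumr_ge0 ?andbT => [|j _]; last first.
    by rewrite mulr_ge0 ?subr_ge0 // ltW.
  under eq_bigr do rewrite mulrBr.
  by rewrite sumrB subr_le0.
rewrite psumr_eq0 => [/allP /(_ i)|j _]; last first.
  by rewrite mulr_ge0 ?subr_ge0 // ltW.
rewrite mem_index_enum => /(_ isT) /=.
by rewrite mulf_eq0 gt_eqF //= subr_eq0 => /eqP.
Qed.

Lemma vlt_vle (n : nat) (a b : 'rV[R]_n) : vlt a b -> vle a b.
Proof. by move=> ab i; apply: ltW. Qed.

Lemma vle_opp (n : nat) (a b : 'rV[R]_n) : vle (- a) (- b) -> vle b a.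
Proof. by move=> ab i; have := ab i; rewrite !mxE lerN2. Qed.

Lemma vscale1 (n : nat) (a : 'rV[R]_n) : vscale (const_mx 1) a = a.
Proof. by apply/rowP => i; rewrite !mxE mul1r. Qed.

(** The vector of multipliers that rescales the [j]-th coordinate by [1 + t] and
leaves the others alone; inputs are contracted with a negative [t]. *)
Definition one_step (n : nat) (j : 'I_n) (t : R) : 'rV[R]_n :=
  const_mx 1 + t *: delta_mx 0 j.

Lemma one_stepE (n : nat) (i j : 'I_n) (t : R) :
  one_step j t 0 i = if i == j then 1 + t else 1.
Proof. by rewrite !mxE eqxx /=; case: eqP => _; rewrite ?mulr1 ?mulr0 ?addr0. Qed.

Lemma sum_one_step (n : nat) (j : 'I_n) (t : R) (f : 'I_n -> R -> R) :
  (forall i, f i 1 = 0) ->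
  \sum_i f i (one_step j t 0 i) = f j (1 + t).
Proof.
move=> f1; rewrite (bigD1 j) //= one_stepE eqxx big1 ?addr0 // => i /negPf ij.
by rewrite one_stepE ij f1.
Qed.

Lemma strong_weak_frontier (m s : nat) (S : set (io R m s)) (p : io R m s) :
  (0 < m)%N -> strong_frontier S p -> weak_frontier S p.
Proof.
move=> m0 [Sp h]; split=> // q q1 q2; apply: h; try exact: vlt_vle.
by move=> qp; have := q1 (Ordinal m0); rewrite qp ltxx.
Qed.

End Row_vectors.

(** * Efficiency in a polyhedron with positive normals *)

Section Slacks.
Context (R : realType) (m s K : nat).
Variables (v : 'I_K -> 'rV[R]_m) (u : 'I_K -> 'rV[R]_s) (psi : 'I_K -> R).
Hypotheses (v_gt0 : forall k, vlt 0 (v k)) (u_gt0 : forall k, vlt 0 (u k)).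
Local Notation E := (pps_exfa v u psi).

Definition slack (k : 'I_K) (p : io R m s) : R :=
  psi k + dot (v k) p.1 - dot (u k) p.2.

Lemma pps_exfaE (p : io R m s) :
  E p <-> [/\ vle 0 p.1, vle 0 p.2 & forall k, 0 <= slack k p].
Proof.
by split=> -[? ? h]; split=> // k; move: (h k); rewrite /slack; lra.
Qed.

(** Domination can only lower [slack k], and keeps it at 0 only if nothing has
moved, because all the weights are positive. *)
Lemma tight_strong_frontier (p : io R m s) (k : 'I_K) :
  E p -> slack k p = 0 -> strong_frontier E p.
Proof.
move=> Ep tight; split=> // q nqp q1 /vle_opp q2 /pps_exfaE[_ _ /(_ k) qk].
have h1 := dot_le (vlt_vle (v_gt0 k)) q1.
have h2 := dot_le (vlt_vle (u_gt0 k)) q2.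
apply: nqp; move: tight qk; rewrite /slack => tight qk.
have e1 : q.1 = p.1 by apply: (dot_le_eq (v_gt0 k)) => //; lra.
have e2 : p.2 = q.2 by apply: (dot_le_eq (u_gt0 k)) => //; lra.
by rewrite (surjective_pairing q) (surjective_pairing p) e1 e2.
Qed.

(** If all inputs and all slacks are positive, the inputs can be shrunk by a
small factor and the outputs shifted up by a small constant without leaving the
technology.  A zero input has to be allowed: it makes a point weakly efficient
for lack of room in the nonnegative orthant. *)
Lemma weak_frontier_tight (p : io R m s) : weak_frontier E p ->
  (exists i, p.1 0 i = 0) \/ (exists k, slack k p = 0).
Proof.
move=> [/pps_exfaE[p1 p2 sl] hw].
have p1i i : 0 <= p.1 0 i by have := p1 i; rewrite mxE.
have p2r r : 0 <= p.2 0 r by have := p2 r; rewrite mxE.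
apply: contrapT => /not_orP[no0 notight].
have x0 i : 0 < p.1 0 i.
  rewrite lt_neqAle p1i andbT eq_sym; apply/eqP => e.
  by apply: no0; exists i.
have s0 k : 0 < slack k p.
  rewrite lt_neqAle sl andbT eq_sym; apply/eqP => e.
  by apply: notight; exists k.
(* Slack used per unit of [eps]; the summand 1 keeps it positive whatever the
   sums are. *)
pose cost k := 1 + dot (v k) p.1 + \sum_r u k 0 r.
have v0 k i : 0 < v k 0 i by have := v_gt0 k i; rewrite mxE.
have u0 k r : 0 < u k 0 r by have := u_gt0 k r; rewrite mxE.
have vx0 k : 0 <= dot (v k) p.1.
  by apply: sumr_ge0 => i _; rewrite mulr_ge0 // ltW.
have us0 k : 0 <= \sum_r u k 0 r by apply: sumr_ge0 => r _; rewrite ltW.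
have cost0 k : 0 < cost k by rewrite /cost; have := vx0 k; have := us0 k; lra.
pose eps := \big[Num.min/1]_k (slack k p / cost k).
have eps0 : 0 < eps by apply/lt_bigmin => // k _; rewrite divr_gt0.
have eps1 : eps <= 1 by apply: bigmin_le_id.
have epsk k : eps * cost k <= slack k p.
  by rewrite -ler_pdivlMr //; apply: bigmin_le.
pose q : io R m s := ((1 - eps) *: p.1, p.2 + const_mx eps).
apply: (hw q).
- by move=> i; rewrite mxE mulrBl mul1r gtrBl mulr_gt0.
- by move=> r; rewrite !mxE ltrN2 ltrDl.
apply/pps_exfaE; split=> /=.
- by move=> i; rewrite !mxE mulr_ge0 // subr_ge0.
- by move=> r; rewrite !mxE addr_ge0 // ltW.
move=> k; rewrite /slack /=.
have -> : dot (v k) ((1 - eps) *: p.1) = (1 - eps) * dot (v k) p.1.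
  by rewrite /dot mulr_sumr; apply: eq_bigr => i _; rewrite mxE mulrCA.
have -> : dot (u k) (p.2 + const_mx eps) =
          dot (u k) p.2 + eps * \sum_r u k 0 r.
  rewrite /dot mulr_sumr -big_split; apply: eq_bigr => i _ /=.
  by rewrite !mxE mulrDr [eps * _]mulrC.
by have := epsk k; rewrite /slack /cost; lra.
Qed.

Lemma slack_vscale (k : 'I_K) (x theta : 'rV[R]_m) (y phi : 'rV[R]_s) :
  slack k (vscale theta x, vscale phi y) =
  slack k (x, y)
    - \sum_i (v k 0 i * x 0 i) * (1 - theta 0 i)
    - \sum_r (u k 0 r * y 0 r) * (phi 0 r - 1).
Proof.
rewrite /slack /dot /=.
have -> : \sum_i v k 0 i * vscale theta x 0 i =
    \sum_i v k 0 i * x 0 i - \sum_i (v k 0 i * x 0 i) * (1 - theta 0 i).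
  by rewrite -sumrB; apply: eq_bigr => i _; rewrite mxE; ring.
have -> : \sum_r u k 0 r * vscale phi y 0 r =
    \sum_r u k 0 r * y 0 r + \sum_r (u k 0 r * y 0 r) * (phi 0 r - 1).
  by rewrite -big_split; apply: eq_bigr => i _ /=; rewrite mxE; ring.
ring.
Qed.

Lemma vscale_pps_exfa (x theta : 'rV[R]_m) (y phi : 'rV[R]_s) :
  vlt 0 x -> vlt 0 y -> vle 0 theta -> vle 0 phi ->
  (forall k, 0 <= slack k (vscale theta x, vscale phi y)) ->
  E (vscale theta x, vscale phi y).
Proof.
move=> x0 y0 t0 p0 h; apply/pps_exfaE; split=> //= i.
- have := x0 i; have := t0 i; rewrite !mxE => ? ?; rewrite mulr_ge0 // ltW //.
- have := y0 i; have := p0 i; rewrite !mxE => ? ?; rewrite mulr_ge0 // ltW //.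
Qed.

(** * The two distances and the loss of the graph measure *)

Section Base_point.
Variables (x : 'rV[R]_m) (y : 'rV[R]_s).
Hypotheses (x_gt0 : vlt 0 x) (y_gt0 : vlt 0 y) (Exy : E (x, y)).
Hypotheses (m_gt0 : (0 < m)%N) (s_gt0 : (0 < s)%N) (K_gt0 : (0 < K)%N).

Local Notation a := (fun k i => v k 0 i * x 0 i).
Local Notation b := (fun k r => u k 0 r * y 0 r).
Local Notation c := (fun k => slack k (x, y)).

Let a_gt0 k i : 0 < a k i.
Proof. by have := v_gt0 k i; have := x_gt0 i; rewrite !mxE => *; rewrite mulr_gt0. Qed.

Let b_gt0 k r : 0 < b k r.
Proof. by have := u_gt0 k r; have := y_gt0 r; rewrite !mxE => *; rewrite mulr_gt0. Qed.

Let c_ge0 k : 0 <= c k.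
Proof. by case/pps_exfaE: Exy. Qed.

(** The distance is the ratio-test length, capped at 1 where the contracted
input reaches 0.  At the cap the optimal point need not be strongly efficient,
only weakly; strictly below it a constraint is tight, which gives the witness
used for the graph measure. *)
Lemma input_distance_attained : exists d : R,
  [/\ 0 <= d <= 1, forall k i, a k i * d <= c k,
      is_min (input_distance_values E x y) d &
      d < 1 -> exists theta : 'rV[R]_m,
        [/\ vle 0 theta, vle theta (const_mx 1),
            strong_frontier E (vscale theta x, y) &
            d = \sum_i (1 - theta 0 i)]].
Proof.
have [t [k0 [i0 [t0 hit below]]]] :=
  first_hit (Ordinal K_gt0) (Ordinal m_gt0) a_gt0 c_ge0.
pose d := Num.min t 1.
have d0 : 0 <= d by rewrite le_min t0 ler01.
have d1 : d <= 1 by rewrite ge_min lexx orbT.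
have dt : d <= t by rewrite ge_min lexx.
have dc k i : a k i * d <= c k.
  by apply: le_trans (below k i); rewrite ler_wpM2l // ltW.
pose theta := one_step i0 (- d).
have th0 : vle 0 theta.
  by move=> i; rewrite one_stepE mxE; case: ifP => _; rewrite ?ler01 ?subr_ge0.
have th1 : vle theta (const_mx 1).
  by move=> i; rewrite one_stepE mxE; case: ifP => // _; rewrite gerBl.
have thd : d = \sum_i (1 - theta 0 i).
  rewrite (@sum_one_step _ _ _ _ (fun _ z => 1 - z)) => [|i]; last by rewrite subrr.
  lra.
have slE k : slack k (vscale theta x, y) = c k - a k i0 * d.
  rewrite -{1}[y]vscale1 slack_vscale.
  rewrite (@sum_one_step _ _ _ _ (fun i z => a k i * (1 - z))) => [|i].
    rewrite big1 => [|r _]; last by rewrite mxE subrr mulr0.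
    ring.
  by rewrite subrr mulr0.
have Eth : E (vscale theta x, y).
  rewrite -[y]vscale1; apply: vscale_pps_exfa => //.
    by move=> r; rewrite !mxE.
  by move=> k; rewrite vscale1 slE subr_ge0.
have strong : d < 1 -> strong_frontier E (vscale theta x, y).
  move=> d_lt1; apply: (@tight_strong_frontier _ k0) => //.
  have dE : d = t.
    by move: d_lt1; rewrite gt_min ltxx orbF => t1; rewrite /d min_l // ltW.
  by rewrite slE dE hit subrr.
exists d; split=> //; [by rewrite d0|split|by move=> /strong; exists theta].
- exists theta; split=> //.
  have [/strong|d_ge1] := ltP d 1; first exact: strong_weak_frontier.
  (* At the cap the input [i0] is 0, so no admissible point is below it. *)
  split=> // q q1 _ /pps_exfaE[/(_ i0) q0 _ _].
  have dE : d = 1 by apply/le_anti; rewrite d1.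
  move: (q1 i0) q0; rewrite /= [vscale _ _ _ _]mxE one_stepE eqxx dE subrr mul0r.
  by rewrite mxE leNgt => ->.
- move=> _ [th [weak t0' t1' ->]].
  have w0 i : 0 <= 1 - th 0 i by have := t1' i; rewrite mxE subr_ge0.
  have [[i]|[k]] := weak_frontier_tight weak.
    rewrite /= mxE => /eqP; rewrite mulf_eq0 => /orP[/eqP thi|/eqP xi].
      apply: (le_trans d1); rewrite (bigD1 i) //= thi subr0 lerDl.
      exact: sumr_ge0.
    by have := x_gt0 i; rewrite xi mxE ltxx.
  rewrite -[y]vscale1 slack_vscale.
  rewrite [X in _ - X]big1 => [|r _]; last by rewrite mxE subrr mulr0.
  move=> tight; apply: (budget_le (Ordinal m_gt0) (a_gt0 k) w0 d0 (dc k)).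
  by move: tight; lra.
Qed.

(** Outputs can grow without bound and the inputs stay positive, so here the
ratio-test length is the distance, and the optimal point is always strongly
efficient. *)
Lemma output_distance_attained : exists d : R,
  [/\ 0 <= d, forall k r, b k r * d <= c k,
      is_min (output_distance_values E x y) d &
      exists r, strong_frontier E (x, vscale (one_step r d) y)].
Proof.
have [d [k0 [r0 [d0 hit below]]]] :=
  first_hit (Ordinal K_gt0) (Ordinal s_gt0) b_gt0 c_ge0.
pose phi := one_step r0 d.
have ph1 : vle (const_mx 1) phi.
  by move=> r; rewrite one_stepE mxE; case: ifP => // _; rewrite lerDl.
have slE k : slack k (x, vscale phi y) = c k - b k r0 * d.
  rewrite -{1}[x]vscale1 slack_vscale.
  rewrite (@sum_one_step _ _ _ _ (fun r z => b k r * (z - 1))) => [|r].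
    rewrite big1 => [|i _]; last by rewrite mxE subrr mulr0.
    ring.
  by rewrite subrr mulr0.
have strong : strong_frontier E (x, vscale phi y).
  apply: (@tight_strong_frontier _ k0); last by rewrite slE hit subrr.
  rewrite -[x]vscale1; apply: vscale_pps_exfa => //.
  - by move=> i; rewrite !mxE.
  - by move=> r; apply: le_trans (ph1 r); rewrite !mxE.
  - by move=> k; rewrite vscale1 slE subr_ge0.
exists d; split=> //; [split|by exists r0].
- exists phi; split=> //; first exact: strong_weak_frontier.
  rewrite (@sum_one_step _ _ _ _ (fun _ z => z - 1)) => [|i]; last by rewrite subrr.
  lra.
- move=> _ [ph [weak p1 ->]].
  have w0 r : 0 <= ph 0 r - 1 by have := p1 r; rewrite mxE subr_ge0.
  have [[i /= xi]|[k]] := weak_frontier_tight weak.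
    by have := x_gt0 i; rewrite xi mxE ltxx.
  rewrite -[x]vscale1 slack_vscale.
  rewrite [X in _ - X - _]big1 => [|i _]; last by rewrite mxE subrr mulr0.
  move=> tight; apply: (budget_le (Ordinal s_gt0) (b_gt0 k) w0 d0 (below k)).
  by move: tight; lra.
Qed.

(** If an input vanishes the loss is at least 1.  Otherwise constraint [k] is
tight, and summing [a k i * dm <= c k] and [b k r * dp <= c k] against the
efforts gives [dm * dp <= p * dp + q * dm], the budget of [mixed_loss_ge]. *)
Lemma russell_loss_ge (dm dp : R) (theta : 'rV[R]_m) (phi : 'rV[R]_s) :
  0 <= dm <= 1 -> (forall k i, a k i * dm <= c k) ->
  0 <= dp -> (forall k r, b k r * dp <= c k) ->
  vle 0 theta -> vle theta (const_mx 1) -> vle (const_mx 1) phi ->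
  weak_frontier E (vscale theta x, vscale phi y) ->
  Num.min dm (dp / (1 + dp)) <=
    \sum_i (1 - theta 0 i) + \sum_r (1 - (phi 0 r)^-1).
Proof.
move=> /andP[dm0 dm1] dma dp0 dpb t0 t1 p1 weak.
have p1' r : 1 <= phi 0 r by have := p1 r; rewrite mxE.
have w0 i : 0 <= 1 - theta 0 i by have := t1 i; rewrite mxE subr_ge0.
have z0 r : 0 <= phi 0 r - 1 by rewrite subr_ge0.
apply: le_trans (lerD (lexx _) (ratio_sum_le p1')).
set p := \sum_i (1 - _); set q := \sum_r (_ - 1).
have p0 : 0 <= p by apply: sumr_ge0.
have q0 : 0 <= q by apply: sumr_ge0.
have [[i]|[k tight]] := weak_frontier_tight weak.
  rewrite /= mxE => /eqP; rewrite mulf_eq0 => /orP[/eqP thi|/eqP xi]; last first.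
    by have := x_gt0 i; rewrite xi mxE ltxx.
  have q1 : 0 <= q / (1 + q) by rewrite divr_ge0 // addr_ge0.
  rewrite ge_min; apply/orP; left; apply: (le_trans dm1).
  rewrite -[leLHS]addr0 lerD // /p (bigD1 i) //= thi subr0 lerDl.
  exact: sumr_ge0.
apply: mixed_loss_ge => //.
have hp := weighted_sum_le w0 (dma k).
have hq := weighted_sum_le z0 (dpb k).
rewrite -/p in hp; rewrite -/q in hq.
move: tight; rewrite slack_vscale => tight.
(* The budget is obtained multiplied by [c k]; when that is zero, [dm = 0]. *)
have [ck|ck] := ltP 0 (c k); last first.
  have : a k (Ordinal m_gt0) * dm <= 0 by apply: le_trans ck.
  rewrite pmulr_rle0 // => dm0'; have -> : dm = 0 by apply/le_anti; rewrite dm0'.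
  by rewrite mul0r mulr0 addr0 mulr_ge0.
rewrite -(ler_pM2l ck).
have := ler_wpM2r dp0 hp; have := ler_wpM2r dm0 hq.
set A := \sum_i _ in tight hp *; set B := \sum_r _ in tight hq *.
have cE : c k = A + B by lra.
by rewrite [X in X * (dm * dp)]cE; lra.
Qed.

End Base_point.
End Slacks.

(** * The graph measure in terms of the two distances *)

Unset Implicit Arguments.
Set Strict Implicit.

Theorem theorem4p5 (R : realType) (m s n : nat)
  (hm : (1 <= m)%N) (hs : (1 <= s)%N) (hn : (1 <= n)%N)
  (X : 'I_n -> 'rV[R]_m) (Y : 'I_n -> 'rV[R]_s)
  (hX : forall j, vlt 0 (X j)) (hY : forall j, vlt 0 (Y j))
  (hfdef : exists F, is_fdef (pps X Y) F)
  (K : nat) (F : 'I_K -> set (io R m s))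
  (hF : set_bij [set: 'I_K] [set G | is_fdef (pps X Y) G] F)
  (v : 'I_K -> 'rV[R]_m) (u : 'I_K -> 'rV[R]_s) (psi : 'I_K -> R)
  (hv : forall k, vlt 0 (v k)) (hu : forall k, vlt 0 (u k))
  (hface : forall k, face_by (pps X Y) (v k) (u k) (psi k) (F k))
  (x : 'rV[R]_m) (y : 'rV[R]_s)
  (hxy : pps X Y (x, y)) (hx : vlt 0 x) (hy : vlt 0 y) :
  let E := pps_exfa v u psi in
  let G := russell_measure E x y in
  let Dm := input_distance E x y in
  let Dp := output_distance E x y in
  [/\ is_max (russell_values E x y) G,
      is_min (input_distance_values E x y) Dm,
      is_min (output_distance_values E x y) Dp &
      G = (m + s)%:R^-1 *
          Num.max ((m + s)%:R - Dm) ((m + s)%:R - Dp / (1 + Dp))].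
Proof.
move=> E G Dm Dp.
have [_ _ surjF] := hF; have [F0 /surjF [k0 _ _]] := hfdef.
have K0 : (0 < K)%N by case: k0 => k /= /(leq_ltn_trans (leq0n k)).
have Exy : E (x, y).
  have [x0 y0 _] := hxy; split=> // k; have [/(_ _ hxy)] := hface k.
  by rewrite /hyperplane_fun subr_le0.
have [dm [dm01 dma dm_min dm_strong]] :=
  input_distance_attained hv hu hx hy Exy hm K0.
have [dp [dp0 dpb dp_min [r strong_r]]] :=
  output_distance_attained hv hu hx hy Exy hm hs K0.
have DmE : Dm = dm by apply: is_min_inf.
have DpE : Dp = dp by apply: is_min_inf.
rewrite DmE DpE.
have dp1 : 0 < 1 + dp by rewrite ltr_wpDr.
pose h := dp / (1 + dp).
have h1 : h < 1 by rewrite ltr_pdivrMr // mul1r ltrDr.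
have N0 : 0 < (m + s)%:R^-1 :> R by rewrite invr_gt0 ltr0n addn_gt0 hm.
(* The Russell value of a point as a function of its loss. *)
pose val (z : R) := (m + s)%:R^-1 * ((m + s)%:R - z).
have valE (theta : 'rV[R]_m) (phi : 'rV[R]_s) :
    (m + s)%:R^-1 * (\sum_i theta 0 i + \sum_r (phi 0 r)^-1) =
    val (\sum_i (1 - theta 0 i) + \sum_r (1 - (phi 0 r)^-1)).
  rewrite /val !sumrB !sumr_const !card_ord natrD; congr (_ * _); ring.
have maxE : Num.max ((m + s)%:R - dm) ((m + s)%:R - h) =
            (m + s)%:R - Num.min dm h.
  rewrite /Num.max /Num.min ltrD2l ltrN2.
  by case: (ltgtP dm h) => // ->.
have gmax : is_max (russell_values E x y) (val (Num.min dm h)).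
  split.
    have [mh|hm'] := ltP dm h.
      have [theta [t0 t1 st dE]] := dm_strong (lt_trans mh h1).
      exists theta, (const_mx 1); split=> //; first by rewrite vscale1.
      rewrite valE -dE [X in _ + X]big1 ?addr0 // => j _.
      by rewrite mxE invr1 subrr.
    exists (const_mx 1), (one_step r dp); split=> //.
    - by move=> i; rewrite !mxE ler01.
    - by move=> i; rewrite one_stepE mxE; case: ifP => // _; rewrite lerDl.
    - by rewrite vscale1.
    rewrite valE [X in X + _]big1 ?add0r => [|j _]; last by rewrite mxE subrr.
    rewrite (@sum_one_step _ _ _ _ (fun _ z => 1 - z^-1)) => [|j].
      by rewrite /h; congr val; field; rewrite gt_eqF.
    by rewrite invr1 subrr.
  move=> _ [theta [phi [t0 t1 p1 st ->]]].
  rewrite valE /val ler_pM2l // lerD2l lerN2.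
  apply: (russell_loss_ge hv hu hx) => //; exact: strong_weak_frontier.
have GE : G = val (Num.min dm h) by apply: is_max_sup.
by split; rewrite ?GE // -/h maxE.
Qed.
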